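(* Let $C\subseteq\mathbb{R}^2$ be a square and $S$ the family of all squares in $\mathbb{R}^2$. Then $\mathrm{PropEF}(C,2,S)\ge 1/4$.
   Context: A value measure on $C$ is $V(X)=\int_X v$ with $v$ non-negative, bounded, integrable on $C$, $V(C)<\infty$; $V^S(X):=\sup\{V(s):s\in S,s\subseteq X\}$. For $n$ agents with value measures $V_1,\dots,V_n$, an $S$-allocation is $(X_1,\dots,X_n)$ with $X_i\in S$ pairwise disjoint and $\bigcup_i X_i\subseteq C$; it is envy-free if $V_i^S(X_i)\ge V_i^S(X_j)$ for all $i,j$. $\mathrm{PropEF}(C,n,S):=\inf_{V_1,\dots,V_n}\sup_X\min_i V_i(X_i)/V_i(C)$, the infimum over all $n$-tuples of value measures on $C$ and the supremum over envy-free $S$-allocations. *)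

(* Defs.v *)
From HB Require Import structures.
From mathcomp Require Import all_boot all_order all_algebra.
From mathcomp Require Import all_classical all_reals all_analysis.
Set Implicit Arguments. Unset Strict Implicit. Unset Printing Implicit Defensive.
Import Order.TTheory GRing.Theory Num.Theory.
Import numFieldNormedType.Exports.
Local Open Scope classical_set_scope.
Local Open Scope ring_scope.

Section Defs.
Variable R : realType.

Definition leb2 := ((@lebesgue_measure R) \x (@lebesgue_measure R))%E.

(* The (closed, solid) square with corner c and edge vector u, the other edge
   being u rotated by +90 degrees.  Any orientation is allowed. *)
Definition square_of (c u : R * R) : set (R * R) :=
  [set p | exists a b : R, [/\ 0 <= a <= 1, 0 <= b <= 1 &
     p = (c.1 + a * u.1 - b * u.2, c.2 + a * u.2 + b * u.1)]].

Definition squares : set (set (R * R)) :=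
  [set X | exists c u : R * R, u != (0, 0) /\ X = square_of c u].

Definition value (v : R * R -> R) (X : set (R * R)) : \bar R :=
  (\int[leb2]_(x in X) (v x)%:E)%E.

(* v is the density of a value measure on C: non-negative, bounded,
   integrable on C (so V(C) < oo); we also require V(C) > 0 so that the
   normalized value V(X)/V(C) makes sense. *)
Definition value_density (C : set (R * R)) (v : R * R -> R) : Prop :=
  [/\ (forall x, C x -> 0 <= v x),
      (exists M : R, forall x, C x -> v x <= M),
      leb2.-integrable C (fun x => (v x)%:E) &
      (0 < value v C)%E].

Definition valueS (S : set (set (R * R))) (v : R * R -> R) (X : set (R * R))
  : \bar R := ereal_sup [set value v s | s in [set s | S s /\ s `<=` X]].

Definition allocation (C : set (R * R)) (n : nat) (S : set (set (R * R)))
  (X : 'I_n -> set (R * R)) : Prop :=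
  [/\ (forall i, S (X i)),
      (forall i, X i `<=` C) &
      (forall i j, i != j -> interior (X i) `&` interior (X j) = set0)].

Definition envy_free (n : nat) (S : set (set (R * R)))
  (v : 'I_n -> R * R -> R) (X : 'I_n -> set (R * R)) : Prop :=
  forall i j, (valueS S (v i) (X j) <= valueS S (v i) (X i))%E.

Definition min_ratio (C : set (R * R)) (n : nat) (v : 'I_n -> R * R -> R)
  (X : 'I_n -> set (R * R)) : \bar R :=
  ereal_inf [set ((fine (value (v i) (X i)) / fine (value (v i) C))%:E)
            | i in [set: 'I_n]].

Definition PropEF (C : set (R * R)) (n : nat) (S : set (set (R * R))) : \bar R :=
  ereal_inf [set ereal_sup [set min_ratio C v X | X in
                   [set X | allocation C S X /\ envy_free S v X]]
            | v in [set v : 'I_n -> R * R -> R | forall i, value_density C (v i)]].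

End Defs.

(* Main.v *)
Require Import Defs.
From HB Require Import structures.
From mathcomp Require Import all_boot all_order all_algebra.
From mathcomp Require Import all_classical all_reals all_analysis.
From mathcomp Require Import measurable_realfun ring lra.
Import Order.TTheory GRing.Theory Num.Theory.
Import numFieldNormedType.Exports.
Local Open Scope classical_set_scope.
Local Open Scope ring_scope.
Set Implicit Arguments. Unset Strict Implicit. Unset Printing Implicit Defensive.

(* Each agent looks at the four quarters of the square. If the two agents have
   different favourite quarters, each receives his own. Otherwise let K(t) be the
   square of relative side t growing from the common favourite corner, and let
   each agent compare K(t) with his best of the three squares of relative side
   1 - t at the other corners. By continuity each agent is indifferent at some
   t in (0, 1); stop at the smaller of the two values, give K(t) to the agent who
   is indifferent there, and to the other one his best rival square. If
   t <= 1/2 the four squares cover the cake, and if t >= 1/2 then K(t) contains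
   the favourite quarter, so in both cases each piece is worth at least 1/4. *)

(** * Null lines in the plane and continuity of integrals over sublevel sets *)

Lemma affine_measurable (R : realType) (al be ga : R) :
  measurable_fun [set: R * R] (fun p : R * R => al * p.1 + be * p.2 + ga).
Proof.
apply: measurable_funD; last exact: measurable_cst.
by apply: measurable_funD;
  apply: measurable_funM.
Qed.

(** A vertical line is a singleton times the real line. Any other line meets each vertical section
    in a single point, so the iterated integral vanishes. *)
Lemma line_null (R : realType) (al be ga : R) : (al, be) != (0, 0) ->
  leb2 [set p : R * R | al * p.1 + be * p.2 + ga = 0] = 0%E.
Proof.
move=> ab0; have [b0|b0] := eqVneq be 0.
  have a0 : al != 0 by apply: contra ab0 => /eqP ->; rewrite b0.
  rewrite [X in leb2 X](_ : _ = [set - ga / al] `*` setT); last first.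
    apply/seteqP; split=> -[x y] /=; rewrite b0 mul0r addr0.
      by move=> h; split=> //; apply: (mulfI a0); rewrite mulrCA divff//; lra.
    by move=> [-> _]; field.
  rewrite /leb2 product_measure1E//.
  by rewrite [X in (X * _)%E]lebesgue_measure_set1 mul0e.
rewrite /leb2 /product_measure1; apply: integral0_eq => x _ /=.
rewrite [X in lebesgue_measure X](_ : _ = [set - (al * x + ga) / be]).
  exact: lebesgue_measure_set1.
apply/seteqP; split=> y; rewrite /xsection /= inE /=.
  by move=> h; apply: (mulfI b0); rewrite mulrCA divff//; lra.
by move=> ->; field.
Qed.

(** Dominated convergence with bound [|v|]: off the null set where [phi x = t], the indicator of
    [phi x <= s] does not change for [s] near [t]. *)
Lemma sublevel_integral_continuous d (T : measurableType d) (R : realType)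
    (mu : {measure set T -> \bar R}) (D : set T) (v phi : T -> R) :
  measurable D -> mu.-integrable D (EFin \o v) -> measurable_fun [set: T] phi ->
  (forall t, mu [set x | phi x = t] = 0%E) ->
  continuous (fun t => fine (\int[mu]_(x in D `&` [set x | phi x <= t]) (v x)%:E)).
Proof.
move=> mD iv mphi phi0 t.
have mle s : measurable [set x | phi x <= s].
  rewrite (_ : [set x | _] = phi @^-1` `]-oo, s]); last first.
    by apply/seteqP; split=> x /=; rewrite in_itv.
  by rewrite -[X in measurable X]setTI; apply: mphi.
have meq : measurable [set x | phi x = t].
  rewrite -[X in measurable X]setTI; exact: (mphi measurableT [set t]).
have iS s : mu.-integrable (D `&` [set x | phi x <= s]) (EFin \o v).
  by apply: integrableS iv => //; apply: measurableI.
(* The same level set, that of the limit [t], is removed for every [s], so all integrals share one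
   domain on which the integrands converge pointwise. *)
have E s : (\int[mu]_(x in D `&` [set x | (phi x <= s)%R]) (v x)%:E =
   \int[mu]_(x in D `\` [set x | phi x = t])
      ((EFin \o v) \_ [set x | (phi x <= s)%R]) x)%E.
  rewrite (negligible_integral meq) //; last exact: measurableI.
  by rewrite -integral_mkcondr; congr integral; apply/seteqP; split=> x /=; tauto.
apply/(@cvg_nbhsP _ R^o) => u ut.
apply: fine_cvg.
rewrite fineK; last first.
  exact: (integrable_fin_num (measurableI _ _ mD (mle t)) (iS t)).
rewrite E; under eq_fun do rewrite E.
apply: (@dominated_cvg _ _ _ mu _ _ (fun n => (EFin \o v) \_ [set x | phi x <= u n])
  ((EFin \o v) \_ [set x | phi x <= t]) (fun x => `|v x|%:E)%E) => //.
- exact: measurableD.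
- move=> n; apply/(measurable_restrict _ (mle (u n))); first exact: measurableD.
  have mv : measurable_fun D (EFin \o v) := measurable_int mu iv.
  by apply: (measurable_funS mD _ mv) => x [[]].
(* Since [phi x] differs from [t], eventually [u n] and [t] lie on the same side of it. *)
- move=> x [Dx /= /eqP phix]; apply: cvg_near_cst.
  have [xt|tx] : phi x < t \/ t < phi x by apply/orP; rewrite -neq_lt.
    near=> n; rewrite /patch !mem_set//=; first exact: ltW.
    by apply: ltW; near: n; exact: (cvgr_gt t).
  near=> n; rewrite /patch !memNset//=; apply/negP; rewrite -ltNge//.
  by near: n; exact: (cvgr_lt t).
- by apply: integrableS (integrable_abse iv) => //; exact: measurableD.
- by move=> n x Dx; rewrite /patch; case: ifP => //=; rewrite normr0 lee_fin.
Unshelve. all: by end_near. Qed.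

(** * Geometry of the squares at the four corners *)

Section corner_squares.
Variable R : realType.
Implicit Types (q : (R * R) * (R * R)) (p : R * R) (t s : R) (v : R * R -> R).

(* A frame [(c, u)] is a corner [c] of the square [square_of c u] together with
   the edge leaving it counterclockwise; [turn] moves to the next corner, so that
   every statement about one corner also covers the other three. *)
Definition turn q := ((q.1.1 + q.2.1, q.1.2 + q.2.2), (- q.2.2, q.2.1)).

(** This is K(t): the whole square for [t = 1], and a single point for [t = 0], which [squares]
    excludes. *)
Definition corner q t := square_of q.1 (t * q.2.1, t * q.2.2).

Definition normsq q := q.2.1 ^+ 2 + q.2.2 ^+ 2.

Definition abscissa q p :=
  ((p.1 - q.1.1) * q.2.1 + (p.2 - q.1.2) * q.2.2) / normsq q.

(** Turning moves the origin along the first edge, which leaves the coordinate along the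
    perpendicular edge unchanged. Facts about abscissas thus transfer to ordinates. *)
Definition ordinate q p := abscissa (turn q) p.

Lemma normsq_gt0 q : q.2 != (0, 0) -> 0 < normsq q.
Proof.
case: q => c [x y] /=; rewrite /normsq /= xpair_eqE negb_and => xy0.
rewrite lt_neqAle addr_ge0 ?sqr_ge0// andbT eq_sym paddr_eq0 ?sqr_ge0//.
by rewrite !sqrf_eq0 negb_and.
Qed.

Lemma turn_neq0 q : q.2 != (0, 0) -> (turn q).2 != (0, 0).
Proof. by rewrite /turn /= !xpair_eqE oppr_eq0 andbC. Qed.

Lemma iter_turn_neq0 k q : q.2 != (0, 0) -> (iter k turn q).2 != (0, 0).
Proof. by move=> q0; elim: k => //= k; exact: turn_neq0. Qed.

Lemma iter_turn4 q : iter 4 turn q = q.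
Proof.
case: q => [[a b] [x y]]; rewrite /turn /=.
by congr ((_, _), (_, _)); ring.
Qed.

Lemma abscissa_turn q p : abscissa (turn q) p = ordinate q p.
Proof. by []. Qed.

Lemma ordinate_turn q p : q.2 != (0, 0) -> ordinate (turn q) p = 1 - abscissa q p.
Proof.
move=> /normsq_gt0 n0; rewrite /ordinate /abscissa.
have -> : normsq (turn (turn q)) = normsq q by rewrite /normsq /=; ring.
by move: n0; rewrite /normsq /= => n0; field; rewrite gt_eqF.
Qed.

(** In frame coordinates the corner square is $[0,t]^2$, which turns the geometric claims below into
    linear inequalities. *)
Lemma cornerE q t : q.2 != (0, 0) -> 0 <= t ->
  corner q t = [set p | 0 <= abscissa q p <= t /\ 0 <= ordinate q p <= t].
Proof.
move=> q0 t0; have n0 := normsq_gt0 q0.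
have n1 : q.2.1 ^+ 2 + q.2.2 ^+ 2 != 0 by rewrite gt_eqF.
have Np : normsq (turn q) = normsq q by rewrite /normsq /=; ring.
rewrite /ordinate /abscissa Np; apply/seteqP; split=> p.
  move=> [a [b [/andP[a0 a1] /andP[b0 b1] ->]]] /=.
  rewrite [X in 0 <= X <= _](_ : _ = a * t); last first.
    by rewrite /normsq; field.
  rewrite [X in _ /\ 0 <= X <= _](_ : _ = b * t); last first.
    by rewrite /normsq; field.
  by rewrite !mulr_ge0// !ler_piMl.
move=> /=; set a := _ / normsq q; set b := _ / normsq q => -[a01 b01].
have pE : p = (q.1.1 + a * q.2.1 - b * q.2.2, q.1.2 + a * q.2.2 + b * q.2.1).
  rewrite [LHS]surjective_pairing /a /b /normsq; congr (_, _).
    by field.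
  by field.
(* The parameters of [p] in the scaled square are [a / t] and [b / t], so the degenerate case
   [t = 0] is handled apart. *)
move: t0; rewrite le_eqVlt => /predU1P[t0|t0].
  exists 0, 0; rewrite !lexx ler01; split=> //=.
  have [a0 b0] : a = 0 /\ b = 0 by lra.
  by rewrite pE a0 b0 -t0; congr (_, _); ring.
exists (a / t), (b / t); split=> /=.
- by rewrite ler_pdivlMr// ler_pdivrMr// mul0r mul1r.
- by rewrite ler_pdivlMr// ler_pdivrMr// mul0r mul1r.
- have tn0 : t != 0 by rewrite gt_eqF.
  by rewrite {1}pE; congr (_, _); field.
Qed.

Lemma corner_sub q s t : q.2 != (0, 0) -> 0 <= s <= t ->
  corner q s `<=` corner q t.
Proof.
move=> q0 /andP[s0 st]; rewrite !cornerE// ?(le_trans s0)// => p /= [a b].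
by split; lra.
Qed.

Lemma corner_turn1 q : q.2 != (0, 0) -> corner (turn q) 1 = corner q 1.
Proof.
move=> q0; rewrite !cornerE ?ler01 ?turn_neq0//; apply/seteqP.
by split=> p /=; rewrite ?(abscissa_turn, ordinate_turn)// => -[]; split; lra.
Qed.

Lemma corner_iter_turn1 k q : q.2 != (0, 0) ->
  corner (iter k turn q) 1 = corner q 1.
Proof.
move=> q0; elim: k => //= k <-; apply: corner_turn1.
exact: iter_turn_neq0.
Qed.

Lemma corner_squares_mem q t : q.2 != (0, 0) -> 0 < t -> squares (corner q t).
Proof.
move=> q0 t0; exists q.1, (t * q.2.1, t * q.2.2); split=> //.
move: q0; case: q.2 => x y /=; rewrite !xpair_eqE !mulf_eq0.
by rewrite (gt_eqF t0).
Qed.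

Lemma corner_cover q t : q.2 != (0, 0) -> 0 <= t <= 2^-1 ->
  corner q 1 `<=` corner q t `|` corner (iter 1 turn q) (1 - t)
    `|` corner (iter 2 turn q) (1 - t) `|` corner (iter 3 turn q) (1 - t).
Proof.
move=> q0 /andP[t0 t2] p.
have s0 : 0 <= 1 - t by lra.
rewrite !cornerE ?ler01 ?iter_turn_neq0//=.
do ?rewrite ?abscissa_turn ?ordinate_turn ?turn_neq0//.
move: (abscissa q p) (ordinate q p) => a b [/andP[a0 a1] /andP[b0 b1]].
(* The lines [a = t] and [b = t] cut the square into four rectangles, one for each corner. The two
   mixed rectangles fit into squares of side [1 - t] because [t <= 1 - t]. *)
have [at'|ta] := leP a t; have [bt|tb] := leP b t.
- by left; left; left; split; lra.
- by right; split; lra.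
- by left; left; right; split; lra.
- by left; right; split; lra.
Qed.

(** A common interior point could be moved slightly both ways along the first edge and stay in both
    sets, so its abscissa would be both below and above [t]. *)
Lemma separated_interior q t (A B : set (R * R)) : q.2 != (0, 0) ->
  (forall p, A p -> abscissa q p <= t) -> (forall p, B p -> t <= abscissa q p) ->
  interior A `&` interior B = set0.
Proof.
move=> q0 At Bt; apply/seteqP; split=> // p [Ap Bp].
have n0 := normsq_gt0 q0.
pose f e : R * R := (p.1 + e * q.2.1, p.2 + e * q.2.2).
have fc : f e @[e --> 0] --> p.
  have line a b : a + e * b @[e --> (0 : R)] --> a.
    rewrite -[X in _ --> X]addr0 -[X in _ --> _ + X](mul0r b).
    by apply: cvgD; [exact: cvg_cst|apply: cvgMl; exact: cvg_id].
  rewrite [X in _ --> X]surjective_pairing.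
  exact: (cvg_pair (line p.1 q.2.1) (line p.2 q.2.2)).
have /nbhs_ballP[e /= e0 h] : nbhs (0 : R) [set e | A (f e) /\ B (f e)].
  exact: (fc _ (filterI Ap Bp)).
have /h [_ /Bt Bl] : ball 0 e (- (e / 2)).
  by rewrite /ball /= sub0r opprK gtr0_norm; lra.
have /h [/At Al _] : ball 0 e (e / 2).
  by rewrite /ball /= sub0r normrN gtr0_norm; lra.
have fE x : abscissa q (f x) = abscissa q p + x.
  by move: n0; rewrite /abscissa /f /normsq /= => n0; field; rewrite gt_eqF.
by move: Al Bl; rewrite !fE; lra.
Qed.

Lemma corner_interior_disjoint q t k : q.2 != (0, 0) -> 0 <= t <= 1 ->
  (0 < k < 4)%N ->
  interior (corner q t) `&` interior (corner (iter k turn q) (1 - t)) = set0.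
Proof.
move=> q0 /andP[t0 t1] k4; have s0 : 0 <= 1 - t by lra.
(* The third corner square is separated from K(t) by the line [ordinate = t], the first and second
   ones by [abscissa = t]. *)
have [k3|k3] := eqVneq k 3%N.
  apply: (@separated_interior (turn q) t); rewrite ?turn_neq0//.
    by move=> p; rewrite cornerE// -/(ordinate q p) => -[]; lra.
  move=> p; rewrite cornerE ?iter_turn_neq0// k3 /=.
  do ?rewrite ?abscissa_turn ?ordinate_turn ?turn_neq0//.
  by rewrite -/(ordinate q p) => -[]; lra.
apply: (@separated_interior q t) => // p; rewrite cornerE ?iter_turn_neq0//.
  by move=> -[]; lra.
have : k = 1%N \/ k = 2%N by case: k k4 k3 => [|[|[|[|k]]]]//; auto.
case=> -> /=.
  by do ?rewrite ?abscissa_turn ?ordinate_turn ?turn_neq0//; move=> -[]; lra.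
do ?rewrite ?abscissa_turn ?ordinate_turn ?turn_neq0//.
by move=> -[]; lra.
Qed.

End corner_squares.
Arguments turn {R} q.

(** * The value of a corner square as a function of its side *)

Section shares.
Variable R : realType.
Implicit Types (q : (R * R) * (R * R)) (p : R * R) (t s : R) (v : R * R -> R).

Lemma abscissaE q : exists al be ga : R, (q.2 != (0, 0) -> (al, be) != (0, 0)) /\
  abscissa q = (fun p => al * p.1 + be * p.2 + ga).
Proof.
exists (q.2.1 / normsq q), (q.2.2 / normsq q),
  (- (q.1.1 * q.2.1 + q.1.2 * q.2.2) / normsq q); split.
  move=> q0; have := normsq_gt0 q0; move: q0.
  case: q => c [x y] /= + n0; rewrite !xpair_eqE !mulf_eq0 invr_eq0.
  by rewrite (gt_eqF n0) !orbF.
by apply/funext => p; rewrite /abscissa; ring.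
Qed.

Lemma abscissa_measurable q : measurable_fun [set: R * R] (abscissa q).
Proof. by have [al [be [ga [_ ->]]]] := abscissaE q; exact: affine_measurable. Qed.

Lemma abscissa_level_measurable q t :
  measurable ([set p | abscissa q p = t] : set (R * R)).
Proof.
rewrite -[X in measurable X]setTI.
exact: (abscissa_measurable q measurableT (measurable_set1 t)).
Qed.

Lemma abscissa_level_null q t : q.2 != (0, 0) ->
  leb2 [set p | abscissa q p = t] = 0%E.
Proof.
move=> q0; have [al [be [ga [/(_ q0) ab0 ->]]]] := abscissaE q.
rewrite -[RHS](line_null (ga - t) ab0); congr leb2; apply/seteqP.
by split=> p /=; lra.
Qed.

(* The corner squares are the sublevel sets of [gauge q] in the cake. *)
Definition gauge q p := Num.max (abscissa q p) (ordinate q p).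

Lemma gauge_measurable q : measurable_fun [set: R * R] (gauge q).
Proof. by apply: measurable_maxr; exact: abscissa_measurable. Qed.

(** A level set of the maximum lies in the union of two lines. *)
Lemma gauge_level_null q t : q.2 != (0, 0) ->
  leb2 [set p | gauge q p = t] = 0%E.
Proof.
move=> q0; apply/eqP; rewrite -measure_le0.
have mg : measurable ([set p | gauge q p = t] : set (R * R)).
  rewrite -[X in measurable X]setTI.
  exact: (gauge_measurable q measurableT (measurable_set1 t)).
apply: (@le_trans _ _ (leb2 ([set p | abscissa q p = t] `|` [set p | abscissa (turn q) p = t]))).
  apply: le_measure; rewrite ?inE//.
    by apply: measurableU; exact: abscissa_level_measurable.
  by move=> p /=; rewrite /gauge; case: leP => _ h; [right|left].
apply: (le_trans (measureU2 _ _ _)); try exact: abscissa_level_measurable.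
rewrite [X in (X + _)%E]abscissa_level_null// [X in (_ + X)%E]abscissa_level_null//.
  by rewrite adde0.
exact: turn_neq0.
Qed.

Lemma corner_measurable q t : q.2 != (0, 0) -> 0 <= t ->
  measurable (corner q t : set (R * R)).
Proof.
move=> q0 t0; rewrite cornerE//.
rewrite (_ : [set p | _] = abscissa q @^-1` `[0, t] `&` abscissa (turn q) @^-1` `[0, t]).
  by apply: measurableI; rewrite -[X in measurable X]setTI; exact: abscissa_measurable.
by apply/seteqP; split=> p /=; rewrite !in_itv.
Qed.

Lemma corner_gauge q t : q.2 != (0, 0) -> 0 <= t <= 1 ->
  corner q 1 `&` [set p | gauge q p <= t] = corner q t.
Proof.
move=> q0 /andP[t0 t1]; rewrite !cornerE//; apply/seteqP.
split=> p /=; rewrite /gauge ge_max.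
  by move=> [[a b] /andP[at' bt]]; split; lra.
by move=> [/andP[a0 a1] /andP[b0 b1]]; split; [split|apply/andP; split]; lra.
Qed.

Definition share v q t := fine (value v (corner q t)).

Section density.
Variables (C : set (R * R)) (v : R * R -> R).
Hypothesis vC : value_density C v.
Variable q : (R * R) * (R * R).
Hypotheses (q0 : q.2 != (0, 0)) (qC : corner q 1 = C).

Lemma cake_measurable : measurable (C : set (R * R)).
Proof. by rewrite -qC; apply: corner_measurable. Qed.

Lemma density_measurable (A : set (R * R)) : measurable A -> A `<=` C ->
  measurable_fun A (EFin \o v).
Proof.
move=> mA AC; case: vC => _ _ iv _.
by apply: (measurable_funS cake_measurable AC (measurable_int _ iv)).
Qed.

Lemma value_fin_num (A : set (R * R)) : measurable A -> A `<=` C ->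
  value v A \is a fin_num.
Proof.
move=> mA AC; case: vC => _ _ iv _.
by apply: integrable_fin_num => //; apply: integrableS iv => //; exact: cake_measurable.
Qed.

Lemma value_sub (A B : set (R * R)) : measurable A -> measurable B ->
  A `<=` B -> B `<=` C -> (value v A <= value v B)%E.
Proof.
move=> mA mB AB BC; case: (vC) => v0 _ _ _.
by apply: ge0_subset_integral => //; [exact: density_measurable|move=> x /BC/v0].
Qed.

(** Replacing [B] by [B \ A] makes the union disjoint, where the integral is additive. *)
Lemma valueU_le (A B : set (R * R)) : measurable A -> measurable B ->
  A `|` B `<=` C -> (value v (A `|` B) <= value v A + value v B)%E.
Proof.
move=> mA mB ABC; case: (vC) => v0 _ _ _.
have mBA : measurable (B `\` A) by exact: measurableD.
have AB : A `|` B = A `|` (B `\` A) by rewrite setDE setUIr setUCr setIT.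
rewrite /value AB ge0_integral_setU//; first last.
- by apply/disj_setPS => p [? []].
- by rewrite -AB => x /ABC/v0.
- by rewrite -AB; apply: density_measurable => //; exact: measurableU.
apply: leeD => //; apply: value_sub => // p Bp.
by apply: ABC; right.
Qed.

Lemma corner_cake t : 0 <= t <= 1 -> corner q t `<=` C.
Proof. by move=> t01; rewrite -qC; exact: corner_sub. Qed.

Lemma shareE t : 0 <= t <= 1 -> (share v q t)%:E = value v (corner q t).
Proof.
move=> t01; rewrite fineK//; apply: value_fin_num; last exact: corner_cake.
by apply: corner_measurable => //; case/andP: t01.
Qed.

Lemma share_mono s t : 0 <= s <= t -> t <= 1 -> share v q s <= share v q t.
Proof.
move=> /andP[s0 st] t1; have t0 := le_trans s0 st.
rewrite -lee_fin !shareE ?s0 ?t0 ?(le_trans st)//.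
apply: value_sub; try exact: corner_measurable.
  by apply: corner_sub; rewrite ?s0.
by apply: corner_cake; rewrite t0.
Qed.

(** For [t] outside [0, 1] the corner square leaves the cake, where [v] is uncontrolled. Continuity
    is therefore stated for a function that agrees with [share] on [0, 1]. *)
Lemma share_continuous : exists F : R -> R, continuous F /\
  forall t, 0 <= t <= 1 -> F t = share v q t.
Proof.
exists (fun t =>
  fine (\int[@leb2 R]_(x in C `&` [set x | gauge q x <= t]) (v x)%:E)); split.
  case: (vC) => _ _ iv _; apply: sublevel_integral_continuous => //.
  - exact: cake_measurable.
  - exact: gauge_measurable.
  - by move=> t; exact: gauge_level_null.
by move=> t t01; rewrite -qC corner_gauge.
Qed.

Lemma share0 : share v q 0 = 0.
Proof.
suff /(congr1 fine) : value v (corner q 0) = 0%E by [].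
have m0 : measurable (corner q 0 : set (R * R)) by exact: corner_measurable.
apply: null_set_integral => //.
  by apply: density_measurable => //; apply: corner_cake; rewrite lexx ler01.
apply/eqP; rewrite -measure_le0 -[leRHS](abscissa_level_null 0 q0).
apply: le_measure; rewrite ?inE//; first exact: abscissa_level_measurable.
by rewrite cornerE// => p /= [a _]; apply/eqP; rewrite eq_le andbC.
Qed.

Lemma share1_gt0 : 0 < share v q 1.
Proof. by case: vC => _ _ _; rewrite -lte_fin shareE ?ler01 ?lexx// qC. Qed.

End density.
End shares.

(** * The moving knife: favourite corners, rivals and crossing times *)

Section moving_knife.
Variable R : realType.
Implicit Types (q : (R * R) * (R * R)) (t s : R) (v w : R * R -> R).
Implicit Types (C A B : set (R * R)).

Definition frame_of C q := q.2 != (0, 0) /\ corner q 1 = C.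

Lemma frame_of_square C : squares C -> exists q, frame_of C q.
Proof.
move=> [c [u [u0 ->]]]; exists (c, u); split=> //.
by rewrite /corner /= !mul1r -surjective_pairing.
Qed.

Lemma frame_of_iter_turn C q k : frame_of C q -> frame_of C (iter k turn q).
Proof.
by move=> [q0 qC]; split; [exact: iter_turn_neq0|rewrite corner_iter_turn1].
Qed.

Lemma favourite v q t : exists j : nat, (j < 4)%N /\
  forall k, share v (iter k turn q) t <= share v (iter j turn q) t.
Proof.
pose f (j : 'I_4) := share v (iter j turn q) t.
have [j _ jmax] := arg_maxP f (erefl : predT (ord0 : 'I_4)).
(* Four turns are the identity, so [k] may be reduced modulo 4. *)
exists j; split=> // k; rewrite (divn_eq k 4) addnC iterD mulnC.
have -> : iter (4 * (k %/ 4)) turn q = q.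
  elim: (k %/ 4)%N => [|n IHn]; first by rewrite muln0.
  by rewrite mulnS iterD IHn iter_turn4.
exact: (jmax (Ordinal (ltn_pmod k (isT : 0 < 4)%N))).
Qed.

Definition rival v q s := Num.max (share v (iter 1 turn q) s)
  (Num.max (share v (iter 2 turn q) s) (share v (iter 3 turn q) s)).

Lemma rival_attained v q s : exists2 k, (0 < k < 4)%N &
  rival v q s = share v (iter k turn q) s.
Proof.
rewrite /rival; case: leP => _; first case: leP => _.
- by exists 3%N.
- by exists 2%N.
- by exists 1%N.
Qed.

Lemma share_le_rival v q s k : (0 < k < 4)%N ->
  share v (iter k turn q) s <= rival v q s.
Proof.
by case: k => [|[|[|[|k]]]]// _; rewrite /rival !le_max lexx ?orbT.
Qed.

Section one_agent.
Variables (C : set (R * R)) (v : R * R -> R).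
Hypothesis vC : value_density C v.
Variable q : (R * R) * (R * R).
Hypothesis qC : frame_of C q.

(** Subadditivity of the value applied to the covering by four corner squares. *)
Lemma share_cover t : 0 <= t <= 2^-1 ->
  share v q 1 <= share v q t + share v (iter 1 turn q) (1 - t)
    + share v (iter 2 turn q) (1 - t) + share v (iter 3 turn q) (1 - t).
Proof.
move=> t2; have [q0 qC1] := qC.
have t01 : 0 <= t <= 1 by lra.
have s01 : 0 <= 1 - t <= 1 by lra.
have fr k : frame_of C (iter k turn q) by exact: frame_of_iter_turn.
have frE k : (share v (iter k turn q) (1 - t))%:E =
    value v (corner (iter k turn q) (1 - t)).
  by have [? ?] := fr k; exact: (shareE vC).
have mK : measurable (corner q t) by apply: corner_measurable => //; case/andP: t01.
have mF k : measurable (corner (iter k turn q) (1 - t)).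
  by have [? _] := fr k; apply: corner_measurable => //; case/andP: s01.
have KC : corner q t `<=` C by exact: corner_cake.
have FC k : corner (iter k turn q) (1 - t) `<=` C.
  by have [? ?] := fr k; exact: corner_cake.
have s11 : 0 <= (1 : R) <= 1 by rewrite ler01 lexx.
rewrite -lee_fin 3!EFinD (frE 1%N) (frE 2%N) (frE 3%N).
rewrite (shareE vC q0 qC1 t01) (shareE vC q0 qC1 s11).
have := corner_cover q0 t2.
set K := corner q t; set K1 := corner (iter 1 _ _) _.
set K2 := corner (iter 2 _ _) _; set K3 := corner (iter 3 _ _) _ => cov.
have U1 : K `|` K1 `<=` C by move=> p [/KC|/(FC 1%N)].
have U2 : K `|` K1 `|` K2 `<=` C by move=> p [/U1|/(FC 2%N)].
have U3 : K `|` K1 `|` K2 `|` K3 `<=` C by move=> p [/U2|/(FC 3%N)].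
have m1 : measurable (K `|` K1) := measurableU _ _ mK (mF 1%N).
have m2 : measurable (K `|` K1 `|` K2) := measurableU _ _ m1 (mF 2%N).
have m3 : measurable (K `|` K1 `|` K2 `|` K3) := measurableU _ _ m2 (mF 3%N).
have m4 : measurable (corner q 1) by exact: corner_measurable.
apply: (le_trans (value_sub vC q0 qC1 m4 m3 cov U3)).
apply: (le_trans (valueU_le vC q0 qC1 m2 (mF 3%N) U3)); apply: leeD => //.
apply: (le_trans (valueU_le vC q0 qC1 m1 (mF 2%N) U2)); apply: leeD => //.
exact: (valueU_le vC q0 qC1 mK (mF 1%N) U1).
Qed.

Lemma rival_mono s t : 0 <= s <= t -> t <= 1 -> rival v q s <= rival v q t.
Proof.
move=> st t1; have [k k4 ->] := rival_attained v q s.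
apply: le_trans (share_le_rival v q t k4).
by have [? ?] := frame_of_iter_turn k qC; exact: (share_mono vC).
Qed.

(** For [t <= 1/2] each of the four covering squares is worth at most the maximum. For larger [t],
    monotonicity carries over the bound at [1/2]. *)
Lemma share_or_rival_ge_quarter t : 0 <= t <= 1 ->
  share v q 1 <= 4 * share v q 2^-1 ->
  share v q 1 <= 4 * Num.max (share v q t) (rival v q (1 - t)).
Proof.
move=> t01 half; have [q0 qC1] := qC.
have [t2|t2] := leP t 2^-1.
  have t02 : 0 <= t <= 2^-1 by lra.
  have := share_cover t02.
  have r k k4 := @share_le_rival v q (1 - t) k k4.
  have := r 1%N isT; have := r 2%N isT; have := r 3%N isT.
  set M := Num.max _ _.
  have : share v q t <= M by rewrite le_max lexx.
  have : rival v q (1 - t) <= M by rewrite le_max lexx orbT.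
  by lra.
apply: (le_trans half); rewrite ler_wpM2l// le_max.
by rewrite (share_mono vC)//; lra.
Qed.

Lemma share_crossing : exists2 t, 0 < t < 1 & share v q t = rival v q (1 - t).
Proof.
have [q0 qC1] := qC.
have fr k := frame_of_iter_turn k qC.
have [F [Fc FE]] := share_continuous vC q0 qC1.
have /choice[G GP] k := share_continuous vC (fr k).1 (fr k).2.
pose h t := F t - Num.max (G 1%N (1 - t)) (Num.max (G 2%N (1 - t)) (G 3%N (1 - t))).
have hE t : 0 <= t <= 1 -> h t = share v q t - rival v q (1 - t).
  by move=> t01; rewrite /h FE// !(GP _).2//; lra.
have hc : continuous h.
  have Gc k : continuous (fun t => G k (1 - t)).
    move=> t; apply: continuous_comp; last exact: (GP k).1.
    by apply: cvgB; [exact: cvg_cst|exact: cvg_id].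
  have maxc (f g : R -> R) : continuous f -> continuous g ->
      continuous (f \max g).
    by move=> fc gc x; apply: (@continuous_max _ _ f g); [exact: fc|exact: gc].
  move=> t; apply: cvgB; first exact: Fc.
  exact: (maxc _ _ (Gc 1%N) (maxc _ _ (Gc 2%N) (Gc 3%N))).
(* At [t = 0] K(t) is worthless while each rival is the whole cake; at [t = 1] the roles are
   reversed. The strict signs keep the zero of [h] off the endpoints, so both squares offered there
   are nondegenerate. *)
have h0 : h 0 < 0.
  rewrite hE ?lexx ?ler01// subr0 (share0 vC)// sub0r oppr_lt0.
  by rewrite lt_max (share1_gt0 vC (fr 1%N).1 (fr 1%N).2).
have h1 : 0 < h 1.
  rewrite hE ?lexx ?ler01// subrr /rival.
  by rewrite !(share0 vC (fr _).1 (fr _).2) !maxxx subr0 (share1_gt0 vC).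
have h01 : Num.min (h 0) (h 1) <= 0 <= Num.max (h 0) (h 1).
  by rewrite ge_min (ltW h0) le_max (ltW h1) orbT.
have [t] := IVT ler01 (continuous_subspaceT hc) h01.
rewrite in_itv/= => t01 ht.
have t0 : t != 0 by apply/eqP => t0; move: ht h0; rewrite t0 => ->; rewrite ltxx.
have t1 : t != 1 by apply/eqP => t1; move: ht h1; rewrite t1 => ->; rewrite ltxx.
exists t; first by move: t01; rewrite !le_eqVlt eq_sym (negPf t0) (negPf t1).
by apply/eqP; rewrite -subr_eq0 -hE// ht.
Qed.

End one_agent.

(** Envy is expressed with [value] rather than [valueS]; the two agree on squares inside the cake.
    The bound of 1/4 is written without division. *)
Definition fair_piece C v A B :=
  (value v B <= value v A)%E /\ fine (value v C) <= 4 * fine (value v A).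

Definition fair_split C v w := exists A B,
  [/\ squares A /\ A `<=` C, squares B /\ B `<=` C,
      interior A `&` interior B = set0, fair_piece C v A B & fair_piece C w B A].

Lemma fair_splitC C v w : fair_split C v w -> fair_split C w v.
Proof. by move=> [A [B [sA sB AB fA fB]]]; exists B, A; split; rewrite // setIC. Qed.

(** * Dividing the cake between two agents *)

Section two_agents.
Variables (C : set (R * R)) (v w : R * R -> R).
Hypotheses (vC : value_density C v) (wC : value_density C w).
Variable q : (R * R) * (R * R).
Hypothesis qC : frame_of C q.

Lemma corner_split t k : 0 < t < 1 -> (0 < k < 4)%N ->
  share v (iter k turn q) (1 - t) <= share v q t ->
  share w q t <= share w (iter k turn q) (1 - t) ->
  share v q 1 <= 4 * share v q t ->
  share w q 1 <= 4 * share w (iter k turn q) (1 - t) ->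
  fair_split C v w.
Proof.
move=> t01 k4 vle wle v4 w4; have [q0 qC1] := qC.
have [q'0 q'C1] := frame_of_iter_turn k qC.
have t01' : 0 <= t <= 1 by lra.
have s01 : 0 <= 1 - t <= 1 by lra.
exists (corner q t), (corner (iter k turn q) (1 - t)); split.
- split; last exact: corner_cake.
  by apply: corner_squares_mem => //; lra.
- split; last exact: corner_cake.
  by apply: corner_squares_mem => //; lra.
- exact: corner_interior_disjoint.
- by split; [rewrite -!(shareE vC)// lee_fin|rewrite -{1}qC1].
- by split; [rewrite -!(shareE wC)// lee_fin|rewrite -{1}qC1].
Qed.

End two_agents.

(** The knife stops at the earlier crossing [s]. The agent [v], indifferent there, takes K(s), and
    [w] takes its best rival square. *)
Lemma first_crossing_split C v w q s t : value_density C v -> value_density C w ->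
  frame_of C q ->
  share v q 1 <= 4 * share v q 2^-1 -> share w q 1 <= 4 * share w q 2^-1 ->
  0 < s -> s <= t -> t < 1 ->
  share v q s = rival v q (1 - s) -> share w q t = rival w q (1 - t) ->
  fair_split C v w.
Proof.
move=> vC wC qC vh wh s0 st t1 vs wt; have [q0 qC1] := qC.
have s01 : 0 <= s <= 1 by lra.
(* Going back from [t] to [s] shrinks K and enlarges the rivals, so [w] still weakly prefers a
   rival. *)
have ws : share w q s <= rival w q (1 - s).
  apply: (@le_trans _ _ (share w q t)).
    by apply: (share_mono wC) => //; lra.
  by rewrite wt; apply: (rival_mono wC) => //; lra.
have [k k4 wk] := rival_attained w q (1 - s).
apply: (corner_split vC wC qC _ k4 (t := s)); first lra.
- by rewrite vs; exact: share_le_rival.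
- by rewrite -wk.
(* Each agent receives the larger of its two options, so the bound on the maximum is a bound on its
   piece. *)
- by have := share_or_rival_ge_quarter vC qC s01 vh; rewrite -vs maxxx.
- by have := share_or_rival_ge_quarter wC qC s01 wh; rewrite max_r// wk.
Qed.

Lemma fair_split_exists C v w : squares C -> value_density C v ->
  value_density C w -> fair_split C v w.
Proof.
move=> /frame_of_square[p qC] vC wC.
have [i [_ iv]] := favourite v p 2^-1.
have {qC} := frame_of_iter_turn i qC.
have {iv} : forall k, share v (iter k turn (iter i turn p)) 2^-1 <=
    share v (iter i turn p) 2^-1 by move=> k; rewrite -iterD.
(* From here the frame is based at a favourite quarter of [v]. *)
move: (iter i turn _) => q vq qC.
have half : 1 - 2^-1 = 2^-1 :> R by lra.
have h02 : 0 <= (2^-1 : R) <= 2^-1 by lra.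
have vh : share v q 1 <= 4 * share v q 2^-1.
  have := share_cover vC qC h02; rewrite half.
  by have := vq 1%N; have := vq 2%N; have := vq 3%N; lra.
have [j [j4 wj]] := favourite w q 2^-1.
have wh : share w q 1 <= 4 * share w (iter j turn q) 2^-1.
  have := share_cover wC qC h02; rewrite half.
  by have := wj 0%N; have := wj 1%N; have := wj 2%N; have := wj 3%N => /=; lra.
(* The value [j = 0] means that [w] shares this favourite. Otherwise the two favourite quarters, at
   [t = 1/2], already form the split. *)
have [j0|j0] := posnP j.
  rewrite {}j0 /= in wh.
  have [s s01 vs] := share_crossing vC qC.
  have [t t01 wt] := share_crossing wC qC.
  have [st|ts] := leP s t.
    by apply: (first_crossing_split vC wC qC vh wh _ st) => //; lra.
  apply: fair_splitC.
  by apply: (first_crossing_split wC vC qC wh vh _ (ltW ts)) => //; lra.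
apply: (corner_split vC wC qC (t := 2^-1) (k := j)); rewrite ?half ?j0//; first lra.
exact: (wj 0%N).
Qed.

(** The supremum is attained at [A] itself, by monotonicity of the value. *)
Lemma valueS_square C v A : squares C -> value_density C v ->
  squares A -> A `<=` C -> valueS (@squares R) v A = value v A.
Proof.
move=> /frame_of_square[q [q0 qC]] vC sA AC.
have msq B : squares B -> measurable B.
  by move=> /frame_of_square[r [r0 <-]]; exact: corner_measurable.
apply/eqP; rewrite eq_le; apply/andP; split.
  apply: ge_ereal_sup => _ [B [sB BA] <-].
  exact: (value_sub vC q0 qC (msq _ sB) (msq _ sA) BA AC).
by apply: ereal_sup_ubound; exists A => //; split.
Qed.

End moving_knife.

Theorem theorem1 (R : realType) (C : set (R * R)) :
  squares C -> ((1 / 4 : R)%:E <= PropEF C 2 (@squares R))%E.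
Proof.
move=> sC; apply: le_ereal_inf_tmp => _ [v vC <-].
have [A [B [[sA AC] [sB BC] AB [vBA vA] [vAB vB]]]] :=
  fair_split_exists sC (vC ord0) (vC ord_max).
pose X (i : 'I_2) := if i == ord0 then A else B.
have I2 (i : 'I_2) : i = ord0 \/ i = ord_max.
  by case: i => -[|[|]]// ?; [left|right]; exact: val_inj.
(* For each pair of densities a single envy-free allocation bounds the supremum from below. *)
apply: (@le_trans _ _ (min_ratio C v X)); last first.
  apply: ereal_sup_ubound; exists X => //; split; first split.
  - by move=> i; rewrite /X; case: ifP.
  - by move=> i; rewrite /X; case: ifP.
  - move=> i j; rewrite /X.
    by case: (I2 i) => ->; case: (I2 j) => ->; rewrite //= setIC.
  - move=> i j; rewrite /X.
    case: (I2 i) => ->; case: (I2 j) => ->; rewrite ?lexx//=.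
      by rewrite !(valueS_square sC (vC ord0)).
    by rewrite !(valueS_square sC (vC ord_max)).
apply: le_ereal_inf_tmp => _ [i _ <-]; rewrite lee_fin.
have VC : 0 < fine (value (v i) C).
  have [q [q0 qC]] := frame_of_square sC.
  by have := share1_gt0 (vC i) q0 qC; rewrite /share qC.
rewrite ler_pdivlMr// /X; case: (I2 i) VC => -> VC /=; lra.
Qed.
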